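(* Let $\mathbf{W}\in\mathbb{R}^{n\times n_-}$ be such that $\operatorname{range}(\mathbf{W})=\operatorname{range}(\mathbf{A}_+^{-1}\mathbf{V}_-)$ and let $$\boldsymbol{\Pi}_3:=\mathbf{I}-\mathbf{W}(\mathbf{W}^\top\mathbf{A}\mathbf{W})^{-1}\mathbf{W}^\top\mathbf{A}.$$ Let $\mathbf{H}_2\in\mathbb{R}^{n\times n}$ be a symmetric positive definite matrix (a preconditioner for $\mathbf{A}_+$) such that all eigenvalues of $\mathbf{H}_2\mathbf{A}_+$ lie in the interval $[\lambda_{\min}(\mathbf{H}_2\mathbf{A}_+),\lambda_{\max}(\mathbf{H}_2\mathbf{A}_+)]$. Let $$\mathbf{H}_{3,\mathrm{ad}}:=\mathbf{H}_2+\mathbf{W}(\mathbf{W}^\top\mathbf{A}\mathbf{W})^{-1}\mathbf{W}^\top,\qquad \mathbf{H}_{3,\mathrm{hyb}}:=\boldsymbol{\Pi}_3\mathbf{H}_2\boldsymbol{\Pi}_3^\top+\mathbf{W}(\mathbf{W}^\top\mathbf{A}\mathbf{W})^{-1}\mathbf{W}^\top.$$ Then $\boldsymbol{\Pi}_3$ is an $\mathbf{A}$-orthogonal projection operator that satisfies $$\operatorname{Ker}(\boldsymbol{\Pi}_3)=\operatorname{range}(\mathbf{A}^{-1}\mathbf{V}_-)\quad\text{and}\quad \operatorname{range}(\boldsymbol{\Pi}_3)=\operatorname{Ker}(\mathbf{A}_-).$$ Moreover, the eigenvalues (denoted $\lambda(\cdot)$) of the preconditioned operators satisfy: $$\lambda_{\min}(\mathbf{H}_2\mathbf{A}_+)\le\lambda(\mathbf{H}_2\mathbf{A}\boldsymbol{\Pi}_3)\le\lambda_{\max}(\mathbf{H}_2\mathbf{A}_+)\quad\text{if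 }\lambda(\mathbf{H}_2\mathbf{A}\boldsymbol{\Pi}_3)\neq0,$$ $$\min(1,\lambda_{\min}(\mathbf{H}_2\mathbf{A}_+))\le\lambda(\mathbf{H}_{3,\mathrm{hyb}}\mathbf{A})\le\max(1,\lambda_{\max}(\mathbf{H}_2\mathbf{A}_+)),$$ $$\min(1,\lambda_{\min}(\mathbf{H}_2\mathbf{A}_+))\le\lambda(\mathbf{H}_{3,\mathrm{ad}}\mathbf{A})\le\lambda_{\max}(\mathbf{H}_2\mathbf{A}_+)+1.$$
   Context: Let $\mathbf{A}\in\mathbb{R}^{n\times n}$ be symmetric positive definite (spd). Let $\Omega^1,\dots,\Omega^N$ be subsets of $\{1,\dots,n\}$ with $\bigcup_{s=1}^N\Omega^s=\{1,\dots,n\}$, and $n^s=\#\Omega^s$. Let $\mathbf{R}^s\in\mathbb{R}^{n^s\times n}$ be the restriction matrix that is zero except that the block formed by the columns in $\Omega^s$ is the $n^s\times n^s$ identity. Let $\mathbf{B}^s\in\mathbb{R}^{n^s\times n^s}$ ($s=1,\dots,N$) be symmetric matrices (possibly indefinite) such that $\mathbf{A}=\sum_{s=1}^N{\mathbf{R}^s}^\top\mathbf{B}^s\mathbf{R}^s$. For each $s$, write $\mathbf{B}^s=\mathbf{V}^s\boldsymbol{\Lambda}^s{\mathbf{V}^s}^\top$ with $\mathbf{V}^s$ orthogonal and $\boldsymbol{\Lambda}^s$ diagonal with diagonal entries in non-decreasing order, and split $\mathbf{V}^s=[\mathbf{V}^s_-|\mathbf{V}^s_+]$, $\boldsymbol{\Lambda}^s=\mathrm{diag}(\boldsymbol{\Lambda}^s_-,\boldsymbol{\Lambda}^s_+)$,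 where $\boldsymbol{\Lambda}^s_-$ contains the non-positive eigenvalues and $\boldsymbol{\Lambda}^s_+$ the positive ones. Set $\mathbf{A}^s_+:=\mathbf{V}^s_+\boldsymbol{\Lambda}^s_+{\mathbf{V}^s_+}^\top$ and $\mathbf{A}^s_-:=-\mathbf{V}^s_-\boldsymbol{\Lambda}^s_-{\mathbf{V}^s_-}^\top$, so $\mathbf{B}^s=\mathbf{A}^s_+-\mathbf{A}^s_-$. Define $\mathbf{A}_+:=\sum_{s=1}^N{\mathbf{R}^s}^\top\mathbf{A}^s_+\mathbf{R}^s$ and $\mathbf{A}_-:=\sum_{s=1}^N{\mathbf{R}^s}^\top\mathbf{A}^s_-\mathbf{R}^s$. (Then $\mathbf{A}=\mathbf{A}_+-\mathbf{A}_-$, $\mathbf{A}_+$ is spd and $\mathbf{A}_-$ is symmetric positive semi-definite.) Let $n_-=\operatorname{rank}(\mathbf{A}_-)$ and let $\mathbf{A}_-=\mathbf{V}_-\boldsymbol{\Lambda}_-\mathbf{V}_-^\top$ be the diagonalization of $\mathbf{A}_-$ with its null part removed: $\boldsymbol{\Lambda}_-\in\mathbb{R}^{n_-\times n_-}$ is diagonal with the positive eigenvalues of $\mathbf{A}_-$, and $\mathbf{V}_-\in\mathbb{R}^{n\times n_-}$ has orthonormal columns. $\mathbf{I}$ is the $n\times n$ identity. $\mathbf{A}$-orthogonal means orthogonal for the inner product $(\mathbf{x},\mathbf{y})\mapsto\langle\mathbf{x},\mathbf{A}\mathbf{y}\rangle$. *)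

(* Defs.v *)
From HB Require Import structures.
From mathcomp Require Import all_boot all_order all_algebra.
From mathcomp Require Import complex.
From mathcomp Require Import classical_sets reals.
Set Implicit Arguments.
Unset Strict Implicit.
Unset Printing Implicit Defensive.
Import Order.TTheory GRing.Theory Num.Theory.
Local Open Scope classical_set_scope.
Local Open Scope complex_scope.
Local Open Scope ring_scope.

(* Vectors of R^n are column vectors; the library's row-space notions
   (%MS, kermx) are not used for ranges and kernels. *)
Definition colrange (R : realType) (m n : nat) (M : 'M[R]_(m, n)) :
  set 'cV[R]_m := range (fun x : 'cV[R]_n => M *m x).

Definition colker (R : realType) (m n : nat) (M : 'M[R]_(m, n)) :
  set 'cV[R]_n := [set x | M *m x = 0].

(* <x, A y> *)
Definition Adot (R : realType) (n : nat) (A : 'M[R]_n) (x y : 'cV[R]_n) : R :=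
  (x^T *m (A *m y)) 0 0.

Definition spd (R : realType) (n : nat) (A : 'M[R]_n) : Prop :=
  A^T = A /\ forall x : 'cV[R]_n, x != 0 -> 0 < Adot A x x.

Definition orthogonal_projection (R : realType) (n : nat) (A P : 'M[R]_n) :
    Prop :=
  P *m P = P /\
  forall x y, colrange P x -> colker P y -> Adot A x y = 0.

(* The eigenvalues of a real matrix are taken in the complex numbers. The
   library's [eigenvalue] uses row eigenvectors, which for a square matrix
   gives the same spectrum as column eigenvectors. *)
Definition spectrum (R : realType) (n : nat) (M : 'M[R]_n) : set R[i] :=
  [set z | eigenvalue (map_mx (real_complex R) M) z].

(* A finite set of reals: when it is nonempty, inf and sup are its minimum and
   maximum. *)
Definition lambda_min (R : realType) (n : nat) (M : 'M[R]_n) : R :=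
  inf [set x : R | spectrum M x%:C].

Definition lambda_max (R : realType) (n : nat) (M : 'M[R]_n) : R :=
  sup [set x : R | spectrum M x%:C].

(* In the order of R[i], u <= v means Im u = Im v and Re u <= Re v, so that
   a%:C <= z <= b%:C says that z is real and lies in [a, b]. *)
Definition in_real_segment (R : realType) (a b : R) (z : R[i]) : Prop :=
  (a%:C <= z <= b%:C)%R.

(* Rows are indexed by S through the increasing enumeration [enum_val] of S. *)
Definition restriction_mx (R : realType) (n : nat) (S : {set 'I_n}) :
  'M[R]_(#|S|, n) := \matrix_(i < #|S|, j < n) (enum_val i == j)%:R.

Definition sum_extend (R : realType) (n N : nat) (Omega : 'I_N -> {set 'I_n})
    (M : forall s, 'M[R]_#|Omega s|) : 'M[R]_n :=
  \sum_(s < N) (restriction_mx R (Omega s))^T *m M s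
    *m restriction_mx R (Omega s).

(* M = V diag(d) V^T with V orthogonal and d non-decreasing *)
Definition sorted_diagonalization (R : realType) (m : nat)
    (M V : 'M[R]_m) (d : 'rV[R]_m) : Prop :=
  [/\ V^T *m V = 1%:M,
      forall i j : 'I_m, (i <= j)%N -> d 0 i <= d 0 j
    & M = V *m diag_mx d *m V^T].

(* Since d is non-decreasing, the columns of V selected by [nonpos_idx d] are
   the leading block V_- and those selected by [pos_idx d] the trailing V_+. *)
Definition nonpos_idx (R : realType) (m : nat) (d : 'rV[R]_m) : {set 'I_m} :=
  [set i | d 0 i <= 0]%SET.

Definition pos_idx (R : realType) (m : nat) (d : 'rV[R]_m) : {set 'I_m} :=
  [set i | 0 < d 0 i]%SET.

Definition cols_in (R : realType) (k m : nat) (S : {set 'I_m})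
    (M : 'M[R]_(k, m)) : 'M[R]_(k, #|S|) :=
  colsub (fun i : 'I_#|S| => enum_val i) M.

Definition plus_part (R : realType) (m : nat) (V : 'M[R]_m) (d : 'rV[R]_m) :
    'M[R]_m :=
  cols_in (pos_idx d) V *m diag_mx (cols_in (pos_idx d) d)
    *m (cols_in (pos_idx d) V)^T.

Definition minus_part (R : realType) (m : nat) (V : 'M[R]_m) (d : 'rV[R]_m) :
    'M[R]_m :=
  - (cols_in (nonpos_idx d) V *m diag_mx (cols_in (nonpos_idx d) d)
       *m (cols_in (nonpos_idx d) V)^T).

Definition Aplus (R : realType) (n N : nat) (Omega : 'I_N -> {set 'I_n})
    (V : forall s, 'M[R]_#|Omega s|) (d : forall s, 'rV[R]_#|Omega s|) :
    'M[R]_n :=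
  sum_extend (fun s => plus_part (V s) (d s)).

Definition Aminus (R : realType) (n N : nat) (Omega : 'I_N -> {set 'I_n})
    (V : forall s, 'M[R]_#|Omega s|) (d : forall s, 'rV[R]_#|Omega s|) :
    'M[R]_n :=
  sum_extend (fun s => minus_part (V s) (d s)).

Definition coarse_solve (R : realType) (n k : nat) (A : 'M[R]_n)
    (W : 'M[R]_(n, k)) : 'M[R]_n :=
  W *m invmx (W^T *m A *m W) *m W^T.

Definition Pi3 (R : realType) (n k : nat) (A : 'M[R]_n) (W : 'M[R]_(n, k)) :
    'M[R]_n :=
  1%:M - coarse_solve A W *m A.

Definition H3ad (R : realType) (n k : nat) (A : 'M[R]_n) (W : 'M[R]_(n, k))
    (H2 : 'M[R]_n) : 'M[R]_n :=
  H2 + coarse_solve A W.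

Definition H3hyb (R : realType) (n k : nat) (A : 'M[R]_n) (W : 'M[R]_(n, k))
    (H2 : 'M[R]_n) : 'M[R]_n :=
  Pi3 A W *m H2 *m (Pi3 A W)^T + coarse_solve A W.

(* Main.v *)
Require Import Defs.
From HB Require Import structures.
From mathcomp Require Import all_boot all_order all_algebra.
From mathcomp Require Import complex ring.
From mathcomp Require Import classical_sets reals.
Set Implicit Arguments.
Unset Strict Implicit.
Unset Printing Implicit Defensive.
Import Order.TTheory GRing.Theory Num.Theory.
Local Open Scope ring_scope.
Local Open Scope sesquilinear_scope.

(** Write N for the minus part and E = (A + N)^-1, F = A^-1, so that E is the
    inverse of the plus part.

    Geometry. By the resolvent identity F - E = E N F, the columns of E V and
    of F V span the same space when V spans the range of N. So range(W) =
    range(F V), the columns of A W span the range of N, and the A-orthogonal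
    projection Pi along range(W) maps onto the orthogonal complement of
    range(N), which is Ker(N) ([deflation_space], [colker_Pi3],
    [colrange_Pi3]).

    Spectra. The point is that A and A + N agree on range(Pi), because N Pi =
    0. Dually Pi E = Pi F ([Pi3_invmxD]), and the coarse correction W (W^T A
    W)^-1 W^T equals F - Pi F. The spectrum of H2 (A + N) lies in [a, b]
    exactly when a E <= H2 <= b E as quadratic forms. One direction needs the
    spectral theorem: H2 (A + N) is made Hermitian by a factorization A + N =
    T^* T over the complex numbers ([pencil_form_bounds],
    [loewner_of_spectrum]). The other direction reads an eigenvalue of H A as
    a Rayleigh quotient of H against F at a row eigenvector
    ([spectrum_preconditioned]), so the last two claims amount to bounds of
    the preconditioners by multiples of F:
    - for the hybrid operator, Pi H2 Pi^T lies between a Pi F and b Pi F,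
      since Pi E Pi^T = Pi F, and the coarse part F - Pi F carries the
      constant 1 ([hybrid_ge], [hybrid_le]);
    - for the additive operator, the lower bound uses E >= Pi E Pi^T = Pi F,
      and the upper one uses E <= F and F - Pi F <= F ([additive_ge],
      [additive_le]).
    For H2 A Pi, a row eigenvector of a nonzero eigenvalue is fixed by Pi, and
    the eigenvalue is a Rayleigh quotient of H2 against E
    ([deflated_spectrum]). *)

(** * Hermitian forms and spectra *)

Lemma adjoint_mul (C : numClosedFieldType) (m n p : nat)
    (M : 'M[C]_(m, n)) (N : 'M[C]_(n, p)) : (M *m N)^t* = N^t* *m M^t*.
Proof. by rewrite trmx_mul map_mxM. Qed.

Lemma hermitian_diagonalization (C : numClosedFieldType) (n : nat)
    (M : 'M[C]_n) : M^t* = M ->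
  exists (P : 'M[C]_n) (D : 'rV[C]_n),
    P \is unitarymx /\ M = P^t* *m diag_mx D *m P.
Proof.
move=> Mh; exists (spectralmx M), (spectral_diag M).
split; first exact: spectral_unitarymx.
rewrite -invmx_unitary ?spectral_unitarymx //.
by apply/orthomx_spectralP/normalmxP; rewrite Mh.
Qed.

Lemma row_unitary_neq0 (C : numClosedFieldType) (n : nat) (P : 'M[C]_n) i :
  P \is unitarymx -> row i P != 0.
Proof.
move=> /unitarymx_unit uP; apply/eqP => Pi0.
have := erefl (delta_mx 0 i : 'rV[C]_n).
rewrite -{1}(mulmxK uP (delta_mx 0 i)) -rowE Pi0 mul0mx.
by move=> /matrixP/(_ 0 i)/eqP; rewrite !mxE !eqxx eq_sym oner_eq0.
Qed.

Lemma diagonalization_eigen (C : numClosedFieldType) (n : nat)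
    (P : 'M[C]_n) (D : 'rV[C]_n) i : P \is unitarymx ->
  row i P *m (P^t* *m diag_mx D *m P) = D 0 i *: row i P.
Proof.
move=> Pu; rewrite -!row_mul !mulmxA (unitarymxP Pu) mul1mx.
by apply/rowP => j; rewrite mul_diag_mx !mxE.
Qed.

(** The coordinates of v in the eigenbasis are the entries of v P^*. *)
Lemma diagonalized_form (C : numClosedFieldType) (n : nat)
    (P : 'M[C]_n) (D : 'rV[C]_n) (v : 'rV[C]_n) :
  (v *m (P^t* *m diag_mx D *m P) *m v^t*) 0 0 =
  \sum_i D 0 i * `|(v *m P^t*) 0 i| ^+ 2.
Proof.
have -> : v *m (P^t* *m diag_mx D *m P) *m v^t*
        = (v *m P^t*) *m diag_mx D *m (v *m P^t*)^t*.
  by rewrite adjoint_mul trmxCK !mulmxA.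
rewrite mul_mx_diag mxE; apply: eq_bigr => i _.
by rewrite !mxE normCK mulrC mulrCA mulrA mulrC mulrA.
Qed.

(** In an orthonormal eigenbasis the form is a combination of squared moduli
    whose weights are eigenvalues. *)
Lemma hermitian_form_bounds (C : numClosedFieldType) (n : nat)
    (M : 'M[C]_n) (a b : C) : M^t* = M ->
    (forall z, eigenvalue M z -> a <= z <= b) ->
  forall v : 'rV[C]_n,
    a * (v *m v^t*) 0 0 <= (v *m M *m v^t*) 0 0 <= b * (v *m v^t*) 0 0.
Proof.
move=> /hermitian_diagonalization [P [D [Pu ->]]] spec v.
have Dab i : a <= D 0 i <= b.
  apply: spec; apply/eigenvalueP; exists (row i P).
    exact: diagonalization_eigen.
  exact: row_unitary_neq0.
have -> : (v *m v^t*) 0 0 = \sum_i `|(v *m P^t*) 0 i| ^+ 2.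
  have -> : v *m v^t* = v *m (P^t* *m diag_mx (const_mx 1) *m P) *m v^t*.
    rewrite diag_const_mx mulmx1 -invmx_unitary // mulVmx ?mulmx1 //.
    exact: unitarymx_unit.
  by rewrite diagonalized_form; apply: eq_bigr => i _; rewrite mxE mul1r.
rewrite diagonalized_form !mulr_sumr.
by apply/andP; split; apply: ler_sum => i _; have /andP[? ?] := Dab i;
  rewrite ler_wpM2r ?exprn_ge0.
Qed.

(** With G = P^* D P and D nonnegative, T = D^(1/2) P. *)
Lemma psd_factorization (C : numClosedFieldType) (n : nat) (G : 'M[C]_n) :
    G^t* = G -> (forall v : 'rV[C]_n, 0 <= (v *m G *m v^t*) 0 0) ->
  exists T : 'M[C]_n, G = T^t* *m T.
Proof.
move=> /hermitian_diagonalization [P [D [Pu GE]]] Gpos.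
have Dpos i : 0 <= D 0 i.
  have := Gpos (row i P); rewrite GE diagonalization_eigen // -scalemxAl mxE.
  have -> : (row i P *m (row i P)^t*) 0 0 = 1.
    move/unitarymxP/matrixP/(_ i i): Pu; rewrite !mxE eqxx => PPi.
    by apply: etrans PPi; apply: eq_bigr => j _; rewrite !mxE.
  by rewrite mulr1.
exists (diag_mx (map_mx sqrtC D) *m P).
rewrite adjoint_mul {1}GE tr_diag_mx map_diag_mx -!mulmxA; congr (_ *m _).
rewrite !mulmxA mul_diag_mx.
congr (_ *m _); apply/matrixP => i j; rewrite !mxE.
have [->|_] := eqVneq i j; last by rewrite !mulr0n mulr0.
rewrite !mulr1n [X in _ = X * _](CrealP _) -?expr2 ?sqrtCK //.
by apply: ger0_real; rewrite sqrtC_ge0.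
Qed.

(** Write G = T^* T. The product H G is not Hermitian, but T H T^* is, and if
    w is a row eigenvector of T H T^* then w T is one of H G for the same
    eigenvalue. So the bounds on the spectrum of H G are bounds on the
    Hermitian form of T H T^*, which is evaluated here at v T^*. *)
Lemma pencil_form_bounds (C : numClosedFieldType) (n : nat)
    (G H : 'M[C]_n) (a b : C) :
    G^t* = G -> G \in unitmx ->
    (forall v : 'rV[C]_n, 0 <= (v *m G *m v^t*) 0 0) ->
    H^t* = H -> (forall z, eigenvalue (H *m G) z -> a <= z <= b) ->
  forall v : 'rV[C]_n,
    a * (v *m G *m v^t*) 0 0 <= (v *m G *m H *m G *m v^t*) 0 0
                             <= b * (v *m G *m v^t*) 0 0.
Proof.
move=> Gh Gu Gpos Hh spec v; have [T GE] := psd_factorization Gh Gpos.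
have uT : T \in unitmx by move: Gu; rewrite GE unitmx_mul => /andP[].
have Mh : (T *m H *m T^t*)^t* = T *m H *m T^t*.
  by rewrite !adjoint_mul trmxCK Hh mulmxA.
have Mspec z : eigenvalue (T *m H *m T^t*) z -> a <= z <= b.
  move=> /eigenvalueP[w wM w0]; apply: spec; apply/eigenvalueP.
  exists (w *m T); first by rewrite GE scalemxAl -wM !mulmxA.
  by apply: contraNneq w0 => wT; rewrite -(mulmxK uT w) wT mul0mx.
have := hermitian_form_bounds Mh Mspec (v *m T^t*).
by rewrite adjoint_mul trmxCK GE !mulmxA.
Qed.

(** * Positive semidefinite real matrices *)

(** An inequality M <= N between symmetric matrices is stated as psd (N - M), so
    that each bound below reduces to writing a difference as a sum of congruences
    of psd matrices. *)
Definition psd (R : realType) (n : nat) (M : 'M[R]_n) : Prop :=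
  M^T = M /\ forall x : 'cV[R]_n, 0 <= Adot M x x.

Lemma AdotE (R : realType) (n : nat) (M : 'M[R]_n) (x y : 'cV[R]_n) :
  Adot M x y = (x^T *m M *m y) 0 0.
Proof. by rewrite /Adot mulmxA. Qed.

Lemma AdotD (R : realType) (n : nat) (M N : 'M[R]_n) (x y : 'cV[R]_n) :
  Adot (M + N) x y = Adot M x y + Adot N x y.
Proof. by rewrite !AdotE mulmxDr mulmxDl mxE. Qed.

Lemma AdotZ (R : realType) (n : nat) (a : R) (M : 'M[R]_n) (x y : 'cV[R]_n) :
  Adot (a *: M) x y = a * Adot M x y.
Proof. by rewrite !AdotE -scalemxAr -scalemxAl mxE. Qed.

Lemma AdotB (R : realType) (n : nat) (M N : 'M[R]_n) (x y : 'cV[R]_n) :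
  Adot (M - N) x y = Adot M x y - Adot N x y.
Proof. by rewrite AdotD -scaleN1r AdotZ mulN1r. Qed.

Lemma Adot_congr (R : realType) (m n : nat) (K : 'M[R]_(m, n)) (M : 'M[R]_n)
    (x : 'cV[R]_m) :
  Adot (K *m M *m K^T) x x = Adot M (K^T *m x) (K^T *m x).
Proof. by rewrite !AdotE trmx_mul trmxK !mulmxA. Qed.

Lemma Adot0 (R : realType) (n : nat) (M : 'M[R]_n) (x : 'cV[R]_n) :
  Adot M x 0 = 0.
Proof. by rewrite AdotE mulmx0 mxE. Qed.

Lemma spd_psd (R : realType) (n : nat) (M : 'M[R]_n) : spd M -> psd M.
Proof.
move=> [Ms Mp]; split=> // x; have [->|/Mp/ltW //] := eqVneq x 0.
by rewrite Adot0.
Qed.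

Lemma psdD (R : realType) (n : nat) (M N : 'M[R]_n) :
  psd M -> psd N -> psd (M + N).
Proof.
move=> [Ms Mp] [Ns Np]; split; first by rewrite linearD /= Ms Ns.
by move=> x; rewrite AdotD addr_ge0.
Qed.

Lemma psdZ (R : realType) (n : nat) (a : R) (M : 'M[R]_n) :
  0 <= a -> psd M -> psd (a *: M).
Proof.
move=> a0 [Ms Mp]; split; first by rewrite linearZ /= Ms.
by move=> x; rewrite AdotZ mulr_ge0.
Qed.

Lemma psd_congr (R : realType) (m n : nat) (K : 'M[R]_(m, n)) (M : 'M[R]_n) :
  psd M -> psd (K *m M *m K^T).
Proof.
move=> [Ms Mp]; split; first by rewrite !trmx_mul trmxK Ms mulmxA.
by move=> x; rewrite Adot_congr.
Qed.

Lemma spd_psdD (R : realType) (n : nat) (M N : 'M[R]_n) :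
  spd M -> psd N -> spd (M + N).
Proof.
move=> [Ms Mp] [Ns Np]; split; first by rewrite linearD /= Ms Ns.
by move=> x x0; rewrite AdotD ltr_wpDr ?Mp.
Qed.

Lemma injective_unitmx (R : fieldType) (n : nat) (M : 'M[R]_n) :
  (forall x : 'cV[R]_n, M *m x = 0 -> x = 0) -> M \in unitmx.
Proof.
move=> Minj; rewrite -unitmx_tr unitmxE unitfE.
apply/negP => /det0P [v v0 vM]; case/eqP: v0; apply: trmx_inj.
by rewrite trmx0; apply: Minj; apply: trmx_inj; rewrite trmx_mul trmxK vM trmx0.
Qed.

Lemma spd_inj (R : realType) (n : nat) (M : 'M[R]_n) (x : 'cV[R]_n) :
  spd M -> Adot M x x = 0 -> x = 0.
Proof.
move=> [_ Mp] Mx0; apply/eqP; apply: contraT => /Mp.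
by rewrite Mx0 ltxx.
Qed.

Lemma spd_unitmx (R : realType) (n : nat) (M : 'M[R]_n) : spd M -> M \in unitmx.
Proof.
move=> Mspd; apply: injective_unitmx => x Mx0; apply: (spd_inj Mspd).
by rewrite /Adot Mx0 mulmx0 mxE.
Qed.

Lemma spd_congr (R : realType) (m n : nat) (K : 'M[R]_(m, n)) (M : 'M[R]_n) :
  spd M -> (forall x : 'cV[R]_m, K^T *m x = 0 -> x = 0) -> spd (K *m M *m K^T).
Proof.
move=> [Ms Mp] Kinj; split; first by rewrite !trmx_mul trmxK Ms mulmxA.
move=> x x0; rewrite Adot_congr; apply: Mp.
by apply: contraNneq x0 => /Kinj ->.
Qed.

Lemma invmx_sym (R : realType) (n : nat) (M : 'M[R]_n) :
  M^T = M -> (invmx M)^T = invmx M.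
Proof. by move=> Ms; rewrite trmx_inv Ms. Qed.

Lemma spd_invmx (R : realType) (n : nat) (M : 'M[R]_n) : spd M -> spd (invmx M).
Proof.
move=> Mspd; have uM := spd_unitmx Mspd; have iMs := invmx_sym Mspd.1.
have -> : invmx M = invmx M *m M *m (invmx M)^T by rewrite iMs mulVmx ?mul1mx.
apply: spd_congr => // x; rewrite iMs => iMx.
by rewrite -(mulKVmx uM x) iMx mulmx0.
Qed.

Lemma psd_diagonalized (R : realType) (n k : nat) (U : 'M[R]_(n, k))
    (l : 'rV[R]_k) : (forall i, 0 < l 0 i) -> psd (U *m diag_mx l *m U^T).
Proof.
move=> l_pos; apply: psd_congr; split; first by rewrite tr_diag_mx.
move=> x; rewrite AdotE mul_mx_diag mxE; apply: sumr_ge0 => i _.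
by rewrite !mxE mulrAC -expr2 mulr_ge0 ?sqr_ge0 // ltW.
Qed.

Lemma invmxB (R : fieldType) (n : nat) (A N : 'M[R]_n) :
    A \in unitmx -> A + N \in unitmx ->
  invmx A - invmx (A + N) = invmx (A + N) *m N *m invmx A.
Proof.
move=> uA uAN.
have {3}-> : N = (A + N) - A by rewrite addrC addKr.
by rewrite mulmxBr mulVmx // mulmxBl mul1mx -mulmxA mulmxV // mulmx1.
Qed.

(** Inversion reverses the order: with E = (A + N)^-1 and F = A^-1, the
    difference F - E = E N F is not visibly symmetric, but one more
    substitution F = E + F N E turns it into E N E + (E N) F (E N)^T. *)
Lemma psd_invmxB (R : realType) (n : nat) (A N : 'M[R]_n) :
  spd A -> psd N -> psd (invmx A - invmx (A + N)).
Proof.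
move=> Aspd Npsd; have Pspd := spd_psdD Aspd Npsd.
have uA := spd_unitmx Aspd; have uP := spd_unitmx Pspd.
have Es := invmx_sym Pspd.1.
set E := invmx (A + N) in Es *; set F := invmx A.
have Fs : F^T = F by rewrite invmx_sym ?Aspd.1.
have FBE : F - E = E *m N *m F by exact: invmxB.
have FE : F = E + E *m N *m F by rewrite -FBE addrC subrK.
have FE' : F = E + F *m N *m E.
  by rewrite -{1}Fs {1}FE linearD /= !trmx_mul Fs Es Npsd.1 mulmxA.
have -> : F - E = E *m N *m E^T + (E *m N) *m F *m (E *m N)^T.
  by rewrite trmx_mul Es Npsd.1 FBE {1}FE' mulmxDr !mulmxA.
apply: psdD; first exact: psd_congr.
by apply: psd_congr; apply: spd_psd; apply: spd_invmx.
Qed.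

(** * Spectral bounds as matrix inequalities *)

Local Notation "M ^C" := (map_mx (real_complex _) M) : ring_scope.

Lemma adjoint_real (R : realType) (m n : nat) (M : 'M[R]_(m, n)) :
  (M^C)^t* = (M^T)^C.
Proof. by apply/matrixP => i j; rewrite !mxE; apply: conjc_real. Qed.

Lemma real_form (R : realType) (n : nat) (M : 'M[R]_n) (x y : 'cV[R]_n) :
  ((x^T)^C *m M^C *m y^C) 0 0 = (Adot M x y)%:C%C.
Proof. by rewrite -!map_mxM mxE AdotE. Qed.

(** For a real symmetric M the cross terms between the real and the imaginary
    part of v cancel, so the Hermitian form of M is real valued and inherits
    bounds from the real quadratic form. *)
Lemma complex_form (R : realType) (n : nat) (M : 'M[R]_n) (v : 'rV[R[i]%C]_n)
    (x := (map_mx (@complex.Re R) v)^T) (y := (map_mx (@complex.Im R) v)^T) :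
  M^T = M ->
  (v *m M^C *m v^t*) 0 0 = (Adot M x x + Adot M y y)%:C%C.
Proof.
move=> Ms; have vE : v = (x^T)^C + 'i%C *: (y^T)^C.
  by apply/rowP => j; rewrite !mxE [LHS]complexE.
have vtE : v^t* = x^C - 'i%C *: y^C.
  apply/colP => j; rewrite !mxE -[LHS]/(conjc _); case: (v 0 j) => p q.
  by rewrite /=; simpc.
(* The bodies of x and y are themselves transposes, which would match trmxK. *)
move: x y vE vtE => x y vE vtE.
have yx : Adot M y x = Adot M x y.
  have tE : x^T *m M *m y = (y^T *m M *m x)^T.
    by rewrite !trmx_mul trmxK Ms mulmxA.
  by rewrite !AdotE tE [RHS]mxE.
rewrite {1}vE vtE !mulmxDl !mulmxDr !mulmxN -!scalemxAl -!scalemxAr.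
rewrite scalerA -expr2 sqr_i scaleN1r opprK.
have D00 (X Y : 'M[R[i]%C]_1) : (X + Y) 0 0 = X 0 0 + Y 0 0 by rewrite mxE.
have N00 (X : 'M[R[i]%C]_1) : (- X) 0 0 = - X 0 0 by rewrite mxE.
have Z00 c (X : 'M[R[i]%C]_1) : (c *: X) 0 0 = c * X 0 0 by rewrite mxE.
by rewrite !(D00, N00, Z00) !real_form yx rmorphD /= addrA addrNK.
Qed.

(** The hypothesis says that z is a quotient of two Hermitian forms, both of
    which are real at v; the quotient is real and obeys the bounds of the two
    forms. *)
Lemma rayleigh_quotient_in_segment (R : realType) (n : nat) (H F : 'M[R]_n)
    (a b : R) (v : 'rV[R[i]%C]_n) (z : R[i]%C) :
    H^T = H -> spd F -> psd (H - a *: F) -> psd (b *: F - H) -> v != 0 ->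
    v *m H^C *m v^t* = z *: (v *m F^C *m v^t*) ->
  in_real_segment a b z.
Proof.
move=> Hs [Fs Fp] [_ aF] [_ bF] v0 /matrixP/(_ 0 0); rewrite [RHS]mxE.
rewrite !complex_form //.
set x := (map_mx (@complex.Re R) v)^T; set y := (map_mx (@complex.Im R) v)^T.
set h := _ + _; set f := (X in z * X%:C%C) => hz.
have f0 : 0 < f.
  have Fge := (spd_psd (conj Fs Fp)).2.
  have [x0|/Fp] := eqVneq x 0; last by move=> ?; rewrite ltr_wpDr.
  have [y0|/Fp] := eqVneq y 0; last by move=> ?; rewrite ltr_wpDl.
  case/eqP: v0; apply/rowP => j; apply/eqP; rewrite eq_complex mxE /=.
  move/colP/(_ j): x0; rewrite !mxE => ->; move/colP/(_ j): y0.
  by rewrite !mxE => ->; rewrite eqxx.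
have zE : z = (h / f)%:C%C.
  rewrite rmorphM fmorphV /= hz mulfK //.
  by rewrite fmorph_eq0 gt_eqF.
rewrite /in_real_segment zE !lecR ler_pdivlMr // ler_pdivrMr //.
have := aF x; have := aF y; have := bF x; have := bF y.
rewrite !AdotB !AdotZ !subr_ge0 => by_ bx ay ax.
by rewrite /f /h !mulrDr !lerD.
Qed.

(** Bounds on the spectrum of H G become a G^-1 <= H <= b G^-1, which is what
    remains usable after deflation: take v with v G = x^T in the bounds for
    the pencil. *)
Lemma loewner_of_spectrum (R : realType) (n : nat) (G H : 'M[R]_n) (a b : R) :
    spd G -> H^T = H ->
    (forall z, spectrum (H *m G) z -> in_real_segment a b z) ->
  psd (H - a *: invmx G) /\ psd (b *: invmx G - H).
Proof.
move=> Gspd Hs spec; have [Gs _] := Gspd; have uG := spd_unitmx Gspd.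
have iGs := invmx_sym Gs; have Gge := (spd_psd Gspd).2.
have Gh : (G^C)^t* = G^C by rewrite adjoint_real Gs.
have Hh : (H^C)^t* = H^C by rewrite adjoint_real Hs.
have uGC : G^C \in unitmx by rewrite map_unitmx.
have Gpos (v : 'rV[R[i]%C]_n) : 0 <= (v *m G^C *m v^t*) 0 0.
  by rewrite complex_form // ler0c addr_ge0.
have specC z : eigenvalue (H^C *m G^C) z -> (a%:C%C <= z <= b%:C%C)%R.
  by rewrite -map_mxM; apply: spec.
have bounds x : a * Adot (invmx G) x x <= Adot H x x <= b * Adot (invmx G) x x.
  have := pencil_form_bounds Gh uGC Gpos Hh specC (((invmx G *m x)^T)^C).
  have -> : ((invmx G *m x)^T)^C *m G^C = (x^T)^C.
    by rewrite -map_mxM trmx_mul iGs mulmxKV.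
  rewrite -[_ *m H^C *m G^C *m _]mulmxA adjoint_real trmxK.
  rewrite -(map_mxM _ G) mulKVmx // map_mxM mulmxA !real_form.
  by rewrite -!rmorphM /= !lecR.
split; split=> [|x]; rewrite ?AdotB ?AdotZ ?subr_ge0;
  try (by case/andP: (bounds x)).
  by rewrite linearB linearZ /= Hs iGs.
by rewrite linearB linearZ /= Hs iGs.
Qed.

(** The converse passage. A row eigenvector v of H A satisfies v H v^* = z v
    A^-1 v^*, because H = (H A) A^-1; a column eigenvector would bring in H^-1
    instead. *)
Lemma spectrum_preconditioned (R : realType) (n : nat) (A H : 'M[R]_n)
    (a b : R) (z : R[i]%C) :
    spd A -> H^T = H -> psd (H - a *: invmx A) -> psd (b *: invmx A - H) ->
  spectrum (H *m A) z -> in_real_segment a b z.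
Proof.
move=> Aspd Hs aH Hb /eigenvalueP[v vHA v0].
apply: (rayleigh_quotient_in_segment Hs (spd_invmx Aspd) aH Hb v0).
rewrite !scalemxAl -vHA; congr (_ *m _).
by rewrite -mulmxA -map_mxM mulmxK ?spd_unitmx.
Qed.

(** A matrix with an eigenvalue has positive size, which the upper additive
    bound needs: for n = 0 the sign of b is arbitrary. *)
Lemma spectrum_neq0 (R : realType) (n : nat) (M : 'M[R]_n) (z : R[i]%C) :
  spectrum M z -> exists x : 'cV[R]_n, x != 0.
Proof.
move=> /eigenvalueP[v _ /rV0Pn[j _]]; exists (delta_mx j 0).
by apply/eqP => /colP/(_ j)/eqP; rewrite !mxE !eqxx oner_eq0.
Qed.

(** * Column spaces *)

Lemma colrange_mulr (R : realType) (m n p : nat) (M : 'M[R]_(m, n))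
    (X : 'M[R]_(n, p)) : (colrange (M *m X) `<=` colrange M)%classic.
Proof. by move=> _ [x _ <-]; exists (X *m x); rewrite ?mulmxA. Qed.

(** Column ranges are the row spaces of the transposes, whose inclusion
    provides the factor. *)
Lemma colrange_factor (R : realType) (m n p : nat) (M : 'M[R]_(m, n))
    (N : 'M[R]_(m, p)) :
  (colrange M `<=` colrange N)%classic -> exists X, M = N *m X.
Proof.
move=> MN; suff /submxP[D MD] : (M^T <= N^T)%MS.
  by exists D^T; rewrite -[M]trmxK MD trmx_mul trmxK.
apply/row_subP => i; rewrite -tr_col colE.
have [y _ <-] : colrange N (M *m delta_mx i 0).
  by apply: MN; exists (delta_mx i 0).
by rewrite trmx_mul submxMl.
Qed.

(** Both inclusions come from the two forms of the resolvent identity, which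
    write each of (A + U D U^T)^-1 U and A^-1 U as the other times a k by k
    matrix. *)
Lemma colrange_invmxD (R : realType) (n k : nat) (A : 'M[R]_n)
    (U : 'M[R]_(n, k)) (D : 'M[R]_k) :
    A \in unitmx -> A + U *m D *m U^T \in unitmx ->
  colrange (invmx (A + U *m D *m U^T) *m U) = colrange (invmx A *m U).
Proof.
move=> uA uP; have uA' : A + U *m D *m U^T + - (U *m D *m U^T) \in unitmx.
  by rewrite addrK.
apply/seteqP; split.
  have -> : invmx (A + U *m D *m U^T) *m U = invmx A *m U *m
      (1%:M - D *m U^T *m invmx (A + U *m D *m U^T) *m U).
    have := invmxB uP uA'; rewrite addrK => EF.
    rewrite mulmxBr mulmx1 -[LHS](subrK (invmx A *m U)) -mulmxBl EF.
    by rewrite addrC !mulmxN !mulNmx !mulmxA.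
  exact: colrange_mulr.
have -> : invmx A *m U = invmx (A + U *m D *m U^T) *m U *m
    (1%:M + D *m U^T *m invmx A *m U).
  rewrite mulmxDr mulmx1 -[LHS](subrK (invmx (A + U *m D *m U^T) *m U)).
  by rewrite -mulmxBl invmxB // addrC !mulmxA.
exact: colrange_mulr.
Qed.

Lemma colker_diagonalized (R : realType) (n k : nat) (U : 'M[R]_(n, k))
    (l : 'rV[R]_k) : U^T *m U = 1%:M -> (forall i, 0 < l 0 i) ->
  colker (U *m diag_mx l *m U^T) = colker U^T.
Proof.
move=> UU l_pos; apply/seteqP; split=> x; rewrite /colker /= => Ux; last first.
  by rewrite -mulmxA Ux mulmx0.
have : diag_mx l *m (U^T *m x) = 0.
  have := congr1 (mulmx U^T) Ux.
  by rewrite mulmx0 -!mulmxA [U^T *m (U *m _)]mulmxA UU mul1mx.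
rewrite mul_diag_mx => /colP lx; apply/colP => i; have := lx i.
by rewrite !mxE => /eqP; rewrite mulf_eq0 gt_eqF //= => /eqP.
Qed.

(** * The coarse projection *)

Lemma coarse_solve_sym (R : realType) (n k : nat) (A : 'M[R]_n)
    (W : 'M[R]_(n, k)) : A^T = A -> (coarse_solve A W)^T = coarse_solve A W.
Proof.
move=> As; rewrite /coarse_solve !trmx_mul trmxK invmx_sym ?mulmxA //.
by rewrite !trmx_mul trmxK As mulmxA.
Qed.

Lemma coarse_solveK (R : realType) (n k : nat) (A : 'M[R]_n)
    (W : 'M[R]_(n, k)) : W^T *m A *m W \in unitmx ->
  coarse_solve A W *m A *m W = W.
Proof.
by move=> uW; rewrite /coarse_solve -!mulmxA [W^T *m _]mulmxA mulVmx ?mulmx1.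
Qed.

Lemma coarse_solveE (R : realType) (n k : nat) (A : 'M[R]_n)
    (W : 'M[R]_(n, k)) : A \in unitmx ->
  coarse_solve A W = invmx A - Pi3 A W *m invmx A.
Proof. by move=> uA; rewrite [_ *m invmx A]mulmxBl mul1mx mulmxK // subKr. Qed.

Lemma tr_Pi3 (R : realType) (n k : nat) (A : 'M[R]_n) (W : 'M[R]_(n, k)) :
  A^T = A -> (Pi3 A W)^T = 1%:M - A *m coarse_solve A W.
Proof.
by move=> As; rewrite linearB /= trmx1 trmx_mul As coarse_solve_sym.
Qed.

Lemma Pi3_selfadjoint (R : realType) (n k : nat) (A : 'M[R]_n)
    (W : 'M[R]_(n, k)) : A^T = A -> (Pi3 A W)^T *m A = A *m Pi3 A W.
Proof.
by move=> As; rewrite tr_Pi3 // /Pi3 mulmxBl mulmxBr mul1mx mulmx1 -mulmxA.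
Qed.

Lemma Pi3_coarse (R : realType) (n k : nat) (A : 'M[R]_n)
    (W : 'M[R]_(n, k)) : W^T *m A *m W \in unitmx -> Pi3 A W *m W = 0.
Proof. by move=> uW; rewrite mulmxBl mul1mx coarse_solveK // subrr. Qed.

Lemma Pi3_idem (R : realType) (n k : nat) (A : 'M[R]_n)
    (W : 'M[R]_(n, k)) : W^T *m A *m W \in unitmx ->
  Pi3 A W *m Pi3 A W = Pi3 A W.
Proof.
move=> uW; rewrite {2}/Pi3 mulmxBr mulmx1 /coarse_solve !mulmxA Pi3_coarse //.
by rewrite !mul0mx subr0.
Qed.

Lemma Pi3_orthogonal (R : realType) (n k : nat) (A : 'M[R]_n)
    (W : 'M[R]_(n, k)) : A^T = A -> W^T *m A *m W \in unitmx ->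
  orthogonal_projection A (Pi3 A W).
Proof.
move=> As uW; split; first exact: Pi3_idem.
move=> _ y [x _ <-] kery; rewrite AdotE trmx_mul -[_ *m A]mulmxA.
by rewrite Pi3_selfadjoint // -!mulmxA kery !mulmx0 mxE.
Qed.

Lemma colker_Pi3 (R : realType) (n k : nat) (A : 'M[R]_n)
    (W : 'M[R]_(n, k)) : W^T *m A *m W \in unitmx ->
  colker (Pi3 A W) = colrange W.
Proof.
move=> uW; apply/seteqP; split=> [x | _ [c _ <-]]; rewrite /colker /=.
  rewrite mulmxBl mul1mx => /eqP; rewrite subr_eq0 => /eqP xE.
  exists (invmx (W^T *m A *m W) *m W^T *m A *m x) => //.
  by rewrite {2}xE /coarse_solve !mulmxA.
by rewrite mulmxA Pi3_coarse // mul0mx.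
Qed.

Lemma tr_mul_Pi3 (R : realType) (n k : nat) (A : 'M[R]_n)
    (U W : 'M[R]_(n, k)) (Y : 'M[R]_k) : A^T = A ->
    W^T *m A *m W \in unitmx -> U = A *m W *m Y ->
  U^T *m Pi3 A W = 0.
Proof.
move=> As uW ->; rewrite !trmx_mul As -!mulmxA -Pi3_selfadjoint //.
by rewrite [W^T *m _]mulmxA -trmx_mul Pi3_coarse // trmx0 mul0mx mulmx0.
Qed.

Lemma colrange_Pi3 (R : realType) (n k : nat) (A : 'M[R]_n)
    (U W : 'M[R]_(n, k)) (X : 'M[R]_k) : A^T = A ->
    A *m W = U *m X -> U^T *m Pi3 A W = 0 ->
  colrange (Pi3 A W) = colker U^T.
Proof.
move=> As AWX UP; apply/seteqP; split=> [_ [x _ <-] | x Ux].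
  by rewrite /colker /= mulmxA UP mul0mx.
exists x => //; rewrite mulmxBl mul1mx /coarse_solve -!mulmxA.
have -> : W^T *m (A *m x) = X^T *m (U^T *m x).
  by rewrite mulmxA -{1}As -trmx_mul AWX trmx_mul mulmxA.
by rewrite Ux !mulmx0 subr0.
Qed.

Lemma spd_galerkin_unitmx (R : realType) (n k : nat) (A : 'M[R]_n)
    (W : 'M[R]_(n, k)) : spd A -> (forall c : 'cV[R]_k, W *m c = 0 -> c = 0) ->
  W^T *m A *m W \in unitmx.
Proof.
move=> Aspd Winj; apply: spd_unitmx; rewrite -[X in _ *m X]trmxK.
by apply: spd_congr => // c; rewrite trmxK; apply: Winj.
Qed.

(** Since W spans A^-1 U, the columns of A W span those of U, with transition
    matrices X and Y. As U is orthonormal these are mutually inverse, so W has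
    independent columns and its Galerkin matrix is positive definite. *)
Lemma deflation_space (R : realType) (n k : nat) (A : 'M[R]_n)
    (U W : 'M[R]_(n, k)) (D : 'M[R]_k) :
    spd A -> A + U *m D *m U^T \in unitmx -> U^T *m U = 1%:M ->
    colrange W = colrange (invmx (A + U *m D *m U^T) *m U) ->
  [/\ W^T *m A *m W \in unitmx, colrange W = colrange (invmx A *m U),
      exists X, A *m W = U *m X & exists Y, U = A *m W *m Y].
Proof.
move=> A_spd uAN UU; have uA := spd_unitmx A_spd.
rewrite colrange_invmxD // => W_range.
have [X WX] : exists X, W = invmx A *m U *m X.
  by apply: colrange_factor; rewrite W_range.
have [Y UY] : exists Y, invmx A *m U = W *m Y.
  by apply: colrange_factor; rewrite W_range.
have AWX : A *m W = U *m X by rewrite WX -!mulmxA mulKVmx.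
have UAY : U = A *m W *m Y by rewrite -mulmxA -UY mulKVmx.
split=> //; [apply: spd_galerkin_unitmx => // c Wc | by exists X | by exists Y].
have YX : Y *m X = 1%:M.
  by apply: mulmx1C; rewrite -UU {2}UAY AWX !mulmxA UU mul1mx.
rewrite -[c]mul1mx -YX -mulmxA -[X *m c]mul1mx -UU -mulmxA.
by rewrite (mulmxA U) -AWX -mulmxA Wc !mulmx0.
Qed.

Lemma Pi3_invmx_sym (R : realType) (n k : nat) (A : 'M[R]_n)
    (W : 'M[R]_(n, k)) : A^T = A -> A \in unitmx ->
  invmx A *m (Pi3 A W)^T = Pi3 A W *m invmx A.
Proof.
move=> As uA; rewrite -[RHS](mulKmx uA) [A *m (_ *m _)]mulmxA.
by rewrite -Pi3_selfadjoint // mulmxK.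
Qed.

(** On the range of the projection A and A + N agree, so (A + N) Pi = A Pi =
    Pi^T A, that is Pi A^-1 = (A + N)^-1 Pi^T; the right-hand sides are then
    compared through their transposes. This identity lets bounds relative to A
    + N act relative to A. *)
Lemma Pi3_invmxD (R : realType) (n k : nat) (A N : 'M[R]_n)
    (W : 'M[R]_(n, k)) : spd A -> psd N -> N *m Pi3 A W = 0 ->
  Pi3 A W *m invmx (A + N) = Pi3 A W *m invmx A.
Proof.
move=> A_spd N_psd NP; have AN_spd := spd_psdD A_spd N_psd.
have uA := spd_unitmx A_spd; have uAN := spd_unitmx AN_spd.
have PFE : Pi3 A W *m invmx A = invmx (A + N) *m (Pi3 A W)^T.
  have -> : Pi3 A W *m invmx A =
      invmx (A + N) *m ((A + N) *m Pi3 A W) *m invmx A by rewrite mulKmx.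
  by rewrite mulmxDl NP addr0 -Pi3_selfadjoint ?A_spd.1 // mulmxA mulmxK.
rewrite -(Pi3_invmx_sym _ A_spd.1 uA) -[in RHS](invmx_sym A_spd.1) -trmx_mul.
by rewrite PFE trmx_mul trmxK (invmx_sym AN_spd.1).
Qed.

(** * The splitting of A *)

Lemma cols_in_diag (R : realType) (k m : nat) (S : {set 'I_m})
    (V : 'M[R]_(k, m)) (d : 'rV[R]_m) :
  cols_in S V *m diag_mx (cols_in S d) *m (cols_in S V)^T =
  \matrix_(i, j) \sum_(l in S) V i l * d 0 l * V j l.
Proof.
apply/matrixP => i j; rewrite mul_mx_diag !mxE [RHS]big_enum_val /=.
by apply: eq_bigr => l _; rewrite !mxE.
Qed.

(** The signs of the entries of d partition the columns of V. *)
Lemma plus_minus_part (R : realType) (m : nat) (V : 'M[R]_m) (d : 'rV[R]_m) :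
  plus_part V d - minus_part V d = V *m diag_mx d *m V^T.
Proof.
rewrite /minus_part opprK /plus_part !cols_in_diag; apply/matrixP => i j.
rewrite mul_mx_diag !mxE [RHS](bigID (mem (pos_idx d))) /=.
congr (_ + _); first by apply: eq_bigr => l _; rewrite !mxE.
apply: eq_big => l; last by rewrite !mxE.
by rewrite !inE leNgt.
Qed.

Lemma AplusE (R : realType) (n N : nat) (Omega : 'I_N -> {set 'I_n})
    (B V : forall s, 'M[R]_#|Omega s|) (d : forall s, 'rV[R]_#|Omega s|) :
    (forall s, sorted_diagonalization (B s) (V s) (d s)) ->
  Aplus V d = sum_extend B + Aminus V d.
Proof.
move=> B_diag; apply/esym; rewrite /Aplus /Aminus /sum_extend -big_split /=.
apply: eq_bigr => s _; have [_ _ ->] := B_diag s.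
by rewrite -mulmxDl -mulmxDr -plus_minus_part subrK.
Qed.

(** * Bounds for the deflated preconditioners *)

Section DeflatedBounds.
Variables (R : realType) (n : nat) (E F H P : 'M[R]_n) (a b : R).
Hypotheses (E_spd : spd E) (F_spd : spd F) (H_spd : spd H).
(* E stands for the inverse of A + N, F for the inverse of A and P for the
   A-orthogonal projection onto the kernel of N; then F - P F is the coarse
   correction. *)
Hypotheses (PP : P *m P = P) (FP : F *m P^T = P *m F) (PE : P *m E = P *m F).
Hypotheses (aH : psd (H - a *: E)) (Hb : psd (b *: E - H)).

Let PFP : P *m F *m P^T = P *m F.
Proof. by rewrite -mulmxA FP mulmxA PP. Qed.

Let PF_psd : psd (P *m F).
Proof. by rewrite -PFP; apply: psd_congr; apply: spd_psd. Qed.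

Let EP : E *m P^T = P *m F.
Proof. by rewrite -{1}E_spd.1 -trmx_mul PE trmx_mul F_spd.1 FP. Qed.

Let compl_congr (M : 'M[R]_n) : M *m P^T = P *m F -> P *m M = P *m F ->
  (1%:M - P) *m M *m (1%:M - P)^T = M - P *m F.
Proof.
move=> MP PM; rewrite linearB /= trmx1 mulmxBl mul1mx PM mulmxBr mulmx1.
by rewrite mulmxBl MP PFP subrr subr0.
Qed.

Let coarse_psd : psd (F - P *m F).
Proof. by rewrite -compl_congr //; apply: psd_congr; apply: spd_psd. Qed.

Let split_psd : psd (E - P *m F).
Proof. by rewrite -compl_congr //; apply: psd_congr; apply: spd_psd. Qed.

(** F is the sum of P F = P E P^T and of the coarse part F - P F. The first is
    bounded through H - a E congruently transformed by P, the second has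
    constant 1. *)
Lemma hybrid_ge :
  psd (P *m H *m P^T + (F - P *m F) - Num.min 1 a *: F).
Proof.
set m := Num.min 1 a.
have -> : P *m H *m P^T + (F - P *m F) - m *: F =
    P *m (H - a *: E) *m P^T + ((a - m) *: (P *m F) + (1 - m) *: (F - P *m F)).
  rewrite mulmxBr mulmxBl -scalemxAr -scalemxAl PE PFP.
  move: (P *m H *m P^T) (P *m F) => X Y.
  by apply/matrixP => i j; rewrite !mxE; ring.
apply: psdD; first exact: psd_congr.
by apply: psdD; apply: psdZ => //; rewrite subr_ge0 ge_min lexx ?orbT.
Qed.

Lemma hybrid_le :
  psd (Num.max 1 b *: F - (P *m H *m P^T + (F - P *m F))).
Proof.
set m := Num.max 1 b.
have -> : m *: F - (P *m H *m P^T + (F - P *m F)) =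
    P *m (b *: E - H) *m P^T + ((m - b) *: (P *m F) + (m - 1) *: (F - P *m F)).
  rewrite mulmxBr mulmxBl -scalemxAr -scalemxAl PE PFP.
  move: (P *m H *m P^T) (P *m F) => X Y.
  by apply/matrixP => i j; rewrite !mxE; ring.
apply: psdD; first exact: psd_congr.
by apply: psdD; apply: psdZ => //; rewrite subr_ge0 le_max lexx ?orbT.
Qed.

(** When the constant m is nonnegative, H >= m E and E >= P E P^T = P F give
    the bound on the part P F; when it is negative, H >= 0 is enough. *)
Lemma additive_ge : psd (H + (F - P *m F) - Num.min 1 a *: F).
Proof.
set m := Num.min 1 a.
have -> : H + (F - P *m F) - m *: F =
    (H - m *: (P *m F)) + (1 - m) *: (F - P *m F).
  move: (P *m F) => X.
  by apply/matrixP => i j; rewrite !mxE; ring.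
apply: psdD; last by apply: psdZ => //; rewrite subr_ge0 ge_min lexx.
have [m0|/ltW m0] := leP 0 m.
  have -> : H - m *: (P *m F) =
      (H - a *: E) + ((a - m) *: E + m *: (E - P *m F)).
    move: (P *m F) => X.
    by apply/matrixP => i j; rewrite !mxE; ring.
  apply: psdD => //; apply: psdD; last exact: psdZ.
  apply: psdZ; first by rewrite subr_ge0 ge_min lexx orbT.
  exact: spd_psd.
rewrite -scaleNr; apply: psdD; first exact: spd_psd.
by apply: psdZ; rewrite ?oppr_ge0.
Qed.

(** H <= b E <= b F uses E <= F and b >= 0, the latter because a positive
    definite H lies below b E at x; and the coarse part is at most F. *)
Lemma additive_le (x : 'cV[R]_n) : psd (F - E) -> x != 0 ->
  psd ((b + 1) *: F - (H + (F - P *m F))).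
Proof.
move=> FE x0; have b0 : 0 <= b.
  have := Hb.2 x; rewrite AdotB AdotZ subr_ge0 => Hbx.
  rewrite -(pmulr_lge0 _ (E_spd.2 x x0)) (le_trans _ Hbx) // ltW //.
  exact: H_spd.2.
have -> : (b + 1) *: F - (H + (F - P *m F)) =
    (b *: E - H) + (b *: (F - E) + P *m F).
  move: (P *m F) => X.
  by apply/matrixP => i j; rewrite !mxE; ring.
by apply: psdD => //; apply: psdD => //; apply: psdZ.
Qed.

(** For z <> 0 a row eigenvector satisfies v P = v, hence v H v^* = v H P^T
    v^* = v (H A P) E v^* = z v E v^*: z is a Rayleigh quotient of H against
    E, with no loss from the deflation. *)
Lemma deflated_spectrum (A : 'M[R]_n) (z : R[i]%C) : A *m F = 1%:M ->
  spectrum (H *m A *m P) z -> z != 0 -> in_real_segment a b z.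
Proof.
move=> AF /eigenvalueP[v vHAP v0] z0.
have vP : v *m P^C = v.
  apply: (scalerI z0); rewrite scalemxAl -vHAP -mulmxA -map_mxM.
  by rewrite -[_ *m P *m P]mulmxA PP.
have HE : H *m P^T = H *m A *m P *m E.
  by rewrite -!mulmxA PE -FP [A *m _]mulmxA AF mul1mx.
apply: (rayleigh_quotient_in_segment H_spd.1 E_spd aH Hb v0).
rewrite !scalemxAl -vHAP -[X in _ = X *m _]mulmxA -map_mxM -HE.
by rewrite map_mxM mulmxA -[RHS]mulmxA -adjoint_real -adjoint_mul vP.
Qed.

End DeflatedBounds.

(** * The preconditioned spectra *)

Theorem theorem8 (R : realType) (n N : nat) (A : 'M[R]_n)
    (Omega : 'I_N -> {set 'I_n})
    (B V : forall s : 'I_N, 'M[R]_#|Omega s|)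
    (d : forall s : 'I_N, 'rV[R]_#|Omega s|)
    (Vm : 'M[R]_(n, \rank (Aminus V d)))
    (lm : 'rV[R]_(\rank (Aminus V d)))
    (W : 'M[R]_(n, \rank (Aminus V d)))
    (H2 : 'M[R]_n)
    (A_spd : spd A)
    (Omega_cover : (\bigcup_(s < N) Omega s = [set: 'I_n])%SET)
    (B_sym : forall s, (B s)^T = B s)
    (A_split : A = sum_extend B)
    (B_diag : forall s, sorted_diagonalization (B s) (V s) (d s))
    (Vm_orthonormal : Vm^T *m Vm = 1%:M)
    (lm_pos : forall i, 0 < lm 0 i)
    (Am_diag : Aminus V d = Vm *m diag_mx lm *m Vm^T)
    (W_range : colrange W = colrange (invmx (Aplus V d) *m Vm))
    (H2_spd : spd H2)
    (H2_spectrum : forall z, spectrum (H2 *m Aplus V d) z ->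
       in_real_segment (lambda_min (H2 *m Aplus V d))
                       (lambda_max (H2 *m Aplus V d)) z) :
  [/\ orthogonal_projection A (Pi3 A W),
      colker (Pi3 A W) = colrange (invmx A *m Vm)
    & colrange (Pi3 A W) = colker (Aminus V d)] /\
  [/\ forall z, spectrum (H2 *m A *m Pi3 A W) z -> z != 0 ->
        in_real_segment (lambda_min (H2 *m Aplus V d))
                        (lambda_max (H2 *m Aplus V d)) z,
      forall z, spectrum (H3hyb A W H2 *m A) z ->
        in_real_segment (Num.min 1 (lambda_min (H2 *m Aplus V d)))
                        (Num.max 1 (lambda_max (H2 *m Aplus V d))) z
    & forall z, spectrum (H3ad A W H2 *m A) z ->
        in_real_segment (Num.min 1 (lambda_min (H2 *m Aplus V d)))
                        (lambda_max (H2 *m Aplus V d) + 1) z].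
Proof.
have N_psd : psd (Aminus V d) by rewrite Am_diag; apply: psd_diagonalized.
have ApE : Aplus V d = A + Aminus V d by rewrite A_split (AplusE B_diag).
rewrite !ApE in W_range H2_spectrum *.
have As := A_spd.1; have uA := spd_unitmx A_spd.
have AN_spd := spd_psdD A_spd N_psd; have uAN := spd_unitmx AN_spd.
have [uW W_rangeA [X AWX] [Y UY]] :
    [/\ W^T *m A *m W \in unitmx, colrange W = colrange (invmx A *m Vm),
        exists X, A *m W = Vm *m X & exists Y, Vm = A *m W *m Y].
  by apply: (deflation_space (D := diag_mx lm)); rewrite // -Am_diag.
have UP : Vm^T *m Pi3 A W = 0 := tr_mul_Pi3 As uW UY.
have NP : Aminus V d *m Pi3 A W = 0 by rewrite {1}Am_diag -mulmxA UP mulmx0.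
split.
  split; first exact: Pi3_orthogonal.
    by rewrite colker_Pi3.
  by rewrite (colrange_Pi3 As AWX UP) [in RHS]Am_diag colker_diagonalized.
have [aH Hb] := loewner_of_spectrum AN_spd H2_spd.1 H2_spectrum.
have E_spd := spd_invmx AN_spd; have F_spd := spd_invmx A_spd.
have PP := Pi3_idem uW; have FP := Pi3_invmx_sym W As uA.
have PE := Pi3_invmxD A_spd N_psd NP; have CE := coarse_solveE W uA.
have Cs := coarse_solve_sym W As.
split=> z.
- exact: (deflated_spectrum E_spd H2_spd PP FP PE aH Hb (mulmxV uA)).
- apply: spectrum_preconditioned => //.
  + by rewrite linearD /= Cs !trmx_mul trmxK H2_spd.1 mulmxA.
  + by rewrite /H3hyb CE; exact: hybrid_ge F_spd PP FP PE aH.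
  + by rewrite /H3hyb CE; exact: hybrid_le F_spd PP FP PE Hb.
move=> spec; have [x x0] := spectrum_neq0 spec.
apply: spectrum_preconditioned spec => //.
- by rewrite linearD /= H2_spd.1 Cs.
- by rewrite /H3ad CE; exact: additive_ge E_spd F_spd H2_spd PP FP PE aH.
- rewrite /H3ad CE.
  exact: (additive_le E_spd F_spd H2_spd PP FP Hb (psd_invmxB A_spd N_psd) x0).
Qed.
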